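(* There is an absolute constant $C$ such that for every integer $n\ge2$, for the $n$-adic filtration $\mathcal D$ of $[0,1]$, every weight $w$ on $[0,1]$, and every $f\in L^2(w)$ with $\int_0^1 f=0$, $$\|f\|_{L^2(w)}\le C\,n\,[w]_{\infty,\mathrm{scl}}^{1/2}\,\|Sf\|_{L^2(w)}.$$
   Context: $[0,1]$ carries Lebesgue measure, $|I|$ denotes length and $\langle f\rangle_I=|I|^{-1}\int_I f$. The $n$-adic filtration: $\mathcal D_0=\{[0,1]\}$ and each interval of $\mathcal D_k$ is split into $n$ consecutive subintervals of equal length (its children $\mathrm{ch}(I)$), forming $\mathcal D_{k+1}$; $\mathcal D=\bigcup_k\mathcal D_k$. Martingale differences: $\Delta_I f=\sum_{I'\in\mathrm{ch}(I)}\langle f\rangle_{I'}\mathbf 1_{I'}-\langle f\rangle_I\mathbf 1_I$; square function $Sf=\big(\sum_{I\in\mathcal D}(\Delta_If)^2\big)^{1/2}$. A weight is an integrable function $w>0$ a.e.; $\|f\|_{L^2(w)}^2=\int_0^1|f|^2w$. Localized maximal function: $M_If(x)=\mathbf 1_I(x)\sup_{J\subseteq I,\,x\in J}|\langle f\rangle_J|$, supremum over all intervals $J\subseteq I$ containing $x$. Semiclassical $A_\infty$ characteristic: $[w]_{\infty,\mathrm{scl}}=\sup_{I\in\mathcal D}\langle M_Iw\rangle_I/\langle w\rangle_I$. *)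

(* Defs.v *)
From HB Require Import structures.
From mathcomp Require Import all_boot all_order all_algebra.
From mathcomp Require Import all_classical all_reals all_analysis.
Set Implicit Arguments. Unset Strict Implicit. Unset Printing Implicit Defensive.
Import Order.TTheory GRing.Theory Num.Theory.
Local Open Scope classical_set_scope.
Local Open Scope ring_scope.

Section Defs.
Variable R : realType.

Notation leb := (@lebesgue_measure R).

Definition avg (a b : R) (g : R -> R) : R :=
  (b - a)^-1 * Rintegral leb `[a, b] g.

Definition eavg (a b : R) (g : R -> \bar R) : \bar R :=
  (((b - a)^-1)%:E * \int[leb]_(x in `[a, b]) g x)%E.

(* n-adic interval I_{k,j} = [j/n^k, (j+1)/n^k], j < n^k, element of D_k.
   (Closed endpoints: boundaries are Lebesgue-null and play no role.) *)
Definition nleft (n k j : nat) : R := j%:R / (n%:R ^+ k).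
Definition nright (n k j : nat) : R := j.+1%:R / (n%:R ^+ k).
Definition nI (n k j : nat) : set R := [set` `[nleft n k j, nright n k j]].

Definition indic (A : set R) (x : R) : R := if `[< A x >] then 1 else 0.

Definition navg (n k j : nat) (f : R -> R) : R := avg (nleft n k j) (nright n k j) f.

(* martingale difference Delta_I f for I = I_{k,j}; its children are
   I_{k+1, n*j+i}, i < n *)
Definition Delta (n k j : nat) (f : R -> R) (x : R) : R :=
  \sum_(i < n) navg n k.+1 (n * j + i) f * indic (nI n k.+1 (n * j + i)) x
  - navg n k j f * indic (nI n k j) x.

Definition Ssq (n : nat) (f : R -> R) (x : R) : \bar R :=
  (\sum_(0 <= k <oo) ((\sum_(j < n ^ k) (Delta n k j f x) ^+ 2)%:E))%E.

Definition locmax (c d : R) (g : R -> R) (x : R) : \bar R :=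
  if `[< [set` `[c, d]] x >] then
    ereal_sup [set y : \bar R | exists a b : R,
      [/\ a < b, c <= a, a <= x, x <= b & b <= d] /\ y = (`|avg a b g|)%:E]
  else 0%E.

Definition Ainf_scl (n : nat) (w : R -> R) : \bar R :=
  ereal_sup [set y : \bar R | exists k j : nat, (j < n ^ k)%N /\
    y = (eavg (nleft n k j) (nright n k j)
              (locmax (nleft n k j) (nright n k j) w)
         * ((navg n k j w)^-1)%:E)%E].

Definition L2w (w f : R -> R) : \bar R :=
  sqrte (\int[leb]_(x in `[0%R, 1%R]) ((f x) ^+ 2 * w x)%:E)%E.

Definition SfL2w (n : nat) (w f : R -> R) : \bar R :=
  sqrte (\int[leb]_(x in `[0%R, 1%R]) (Ssq n f x * (w x)%:E))%E.

Definition is_weight (w : R -> R) : Prop :=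
  leb.-integrable `[0, 1] (EFin \o w) /\
  {ae leb, forall x, [set` `[0, 1]] x -> 0 < w x}.

End Defs.

(* Main.v *)
(** Write [F_k], [W_k] for the averages of [f], [w] over the [n]-adic interval of
    generation [k] containing a point, and [d_k] for the martingale differences
    of [f].  The pathwise Doob inequality bounds the square of the running
    maximum of [|F|] by [8 * sum d_k ^ 2] plus [sum h_(k-1) * d_k], where [h] is
    predictable and dominated by the running maximum.  Since [d_k] has mean zero
    on [I], the weighted mean of [d_k] over the children of [I] only sees the
    oscillation of [w] among them: its square is at most the weighted mean of
    [d_k ^ 2] times
    [18 n * sqrt <w>_I * (sqrt <w>_I - mean over children of sqrt <w>_I')].
    These coefficients form a Carleson sequence with respect to [w], with
    constant the [A_infty] characteristic, because [sqrt (M W) - M], with [M] the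
    running maximum of [W], is a potential for them.  The Carleson embedding for
    the increasing running maximum of [|F|] then absorbs the linear term, and one
    lets the generation tend to infinity by Lebesgue differentiation and Fatou's
    lemma. *)

Require Import Defs.
From HB Require Import structures.
From mathcomp Require Import all_boot all_order all_algebra.
From mathcomp Require Import all_classical all_reals all_analysis.
From mathcomp Require Import measurable_realfun ring lra.
Import Order.TTheory GRing.Theory Num.Theory.
Import numFieldNormedType.Exports.
Set Implicit Arguments. Unset Strict Implicit. Unset Printing Implicit Defensive.
Local Open Scope classical_set_scope.
Local Open Scope ring_scope.

(** * Square functions on a tree *)

Section Mean.
Variables (R : rcfType) (n : nat).
Implicit Types (x y : 'I_n -> R).

Definition mean x : R := n%:R^-1 * \sum_(i < n) x i.

Lemma meanD x y : mean (fun i => x i + y i) = mean x + mean y.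
Proof. by rewrite /mean big_split mulrDr. Qed.

Lemma meanZ c x : mean (fun i => c * x i) = c * mean x.
Proof. by rewrite /mean -mulr_sumr mulrCA. Qed.

Lemma le_mean x y : (forall i, x i <= y i) -> mean x <= mean y.
Proof. by move=> h; rewrite ler_wpM2l ?invr_ge0 ?ler0n// ler_sum. Qed.

Lemma eq_mean x y : x =1 y -> mean x = mean y.
Proof. by move=> h; rewrite /mean (eq_bigr _ (fun i _ => h i)). Qed.

Lemma mean_ge0 x : (forall i, 0 <= x i) -> 0 <= mean x.
Proof. by move=> h; rewrite mulr_ge0 ?invr_ge0 ?ler0n// sumr_ge0. Qed.

Lemma meanB x y : mean (fun i => x i - y i) = mean x - mean y.
Proof. by rewrite /mean sumrB mulrBr. Qed.

Hypothesis n0 : (0 < n)%N.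

Lemma mean_cst c : mean (fun=> c) = c.
Proof.
rewrite /mean sumr_const card_ord -[c *+ n]mulr_natl mulrA mulVf ?mul1r//.
by rewrite pnatr_eq0 -lt0n.
Qed.

Lemma le_mean_term x i : (forall j, 0 <= x j) -> x i <= n%:R * mean x.
Proof.
move=> x0; rewrite /mean mulrA mulfV ?pnatr_eq0 -?lt0n// mul1r.
by rewrite (bigD1 i)//= lerDl sumr_ge0.
Qed.

(* If every child has at least a quarter of the average weight, compare [w]
   with its average; otherwise [r] times the concavity gap of the square root is
   at least of order [r ^+ 2 / n] and the trivial bound suffices. *)
Lemma drift_bound (d w : 'I_n -> R) (h l r : R) : 0 < l -> 0 <= r ->
  (forall i, 0 <= w i) -> mean d = 0 -> mean w = r ^+ 2 ->
  h * mean (fun i => d i * w i) <=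
    l * mean (fun i => d i ^+ 2 * w i) +
    h ^+ 2 / (4 * l) * (18 * n%:R * (r * (r - mean (fun i => Num.sqrt (w i))))).
Proof.
move=> l0 r0 w0 d0 wr; set g := r - _.
pose s i := Num.sqrt (w i).
have sw i : w i = s i ^+ 2 by rewrite sqr_sqrtr.
have s0 i : 0 <= s i by exact: sqrtr_ge0.
have gap : mean (fun i => (s i - r) ^+ 2) = 2 * (r * g).
  rewrite (@eq_mean _ (fun i => (w i - (2 * r) * s i) + r ^+ 2)); last first.
    by move=> i; rewrite sw; ring.
  by rewrite meanD mean_cst meanB meanZ wr /g -/s; ring.
have n1 : 1 <= n%:R :> R by rewrite ler1n.
have rg0 : 0 <= r * g.
  have := @mean_ge0 (fun i => (s i - r) ^+ 2) (fun i => sqr_ge0 _); rewrite gap; lra.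
have l4 : 0 < 4 * l by lra.
have hl0 : 0 <= h ^+ 2 / (4 * l) by rewrite divr_ge0 ?sqr_ge0// ltW.
rewrite -!meanZ.
case: (boolP [forall i, r <= 2 * s i]) => [/forallP big|].
  (* Since [d] has mean zero, the average [r ^+ 2] can be subtracted from the weight for free. *)
  have -> : mean (fun i => h * (d i * w i)) =
            mean (fun i => h * (d i * (w i - r ^+ 2))).
    rewrite [RHS](@eq_mean _ (fun i => h * (d i * w i) - (h * r ^+ 2) * d i)).
      by rewrite meanB [mean (fun i => _ * d i)]meanZ d0 mulr0 subr0.
    by move=> i; ring.
  apply: (@le_trans _ _ (mean (fun i => l * (d i ^+ 2 * w i) +
      (h ^+ 2 / (4 * l) * 9) * (s i - r) ^+ 2))).
    apply: le_mean => i; rewrite sw.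
    have Hi := big i; have s0i := s0 i.
    rewrite -(ler_pM2l l4).
    have -> : 4 * l * (l * (d i ^+ 2 * s i ^+ 2) +
      h ^+ 2 / (4 * l) * 9 * (s i - r) ^+ 2) =
      (2 * l * d i * s i) ^+ 2 + (h * (s i - r) * 3) ^+ 2.
      by field; lra.
    (* From [r <= 2 * s i] one gets [s i + r <= 3 * s i]; when [s i = 0] also [r = 0] and any ratio
       serves. The square of this 3 is the factor 9 above. *)
    have [t_ [t0 t3]] : exists t, 0 <= t <= 3 /\ s i + r = t * s i.
      have [si0|sn] := eqVneq (s i) 0.
        by exists 0; split; [lra|lra].
      exists ((s i + r) / s i); split; last by rewrite divfK.
      have sp : 0 < s i by rewrite lt_def sn s0i.
      by rewrite divr_ge0 ?addr_ge0//= ler_pdivrMr//; lra.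
    have -> : s i ^+ 2 - r ^+ 2 = (s i - r) * (t_ * s i) by rewrite -t3; ring.
    have -> : 4 * l * (h * (d i * ((s i - r) * (t_ * s i)))) =
       2 * (2 * l * d i * s i) * (h * (s i - r) * t_) by ring.
    set X := 2 * l * d i * s i; set Y := h * (s i - r).
    have : 0 <= (X - Y * t_) ^+ 2 by exact: sqr_ge0.
    have : (Y * t_) ^+ 2 <= (Y * 3) ^+ 2.
      rewrite exprMn [leRHS]exprMn ler_wpM2l ?sqr_ge0//; nra.
    by lra.
  rewrite meanD !meanZ gap lerD2l.
  rewrite -mulrA ler_wpM2l//.
  have -> : 9 * (2 * (r * g)) = 18 * (r * g) by ring.
  rewrite -[leRHS]mulrA; rewrite ler_wpM2l ?ler_peMl//.
rewrite negb_forall => /existsP[i0]; rewrite -ltNge => small.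
apply: (@le_trans _ _ (mean (fun i => l * (d i ^+ 2 * w i) +
    (h ^+ 2 / (4 * l)) * w i))).
  apply: le_mean => i; rewrite sw -(ler_pM2l l4).
  have -> : 4 * l * (l * (d i ^+ 2 * s i ^+ 2) + h ^+ 2 / (4 * l) * s i ^+ 2) =
     ((2 * l * d i) ^+ 2 + h ^+ 2) * s i ^+ 2 by field; lra.
  have -> : 4 * l * (h * (d i * s i ^+ 2)) = (2 * (2 * l * d i) * h) * s i ^+ 2.
    by ring.
  rewrite ler_wpM2r ?sqr_ge0//.
  have := sqr_ge0 (2 * l * d i - h); lra.
rewrite meanD !meanZ lerD2l ler_wpM2l// wr.
have := @le_mean_term _ i0 (fun j => sqr_ge0 (s j - r)); rewrite gap => H.
(* The light child has [s i0 < r / 2], so [r ^+ 2 / 4 <= 2 * n * r * g], that is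
   [r ^+ 2 <= 8 * n * r * g], within the constant 18. *)
have H2 : (r / 2) ^+ 2 <= (s i0 - r) ^+ 2.
  rewrite -[leRHS]sqrrN opprB ler_sqr ?nnegrE; have := s0 i0; lra.
have : 0 <= n%:R * (r * g) by rewrite mulr_ge0// ler0n.
by lra.
Qed.

End Mean.

(** * Path-dependent averages on the [n]-ary tree *)

Section Tree.
Variables (R : rcfType) (n : nat) (T : Type) (child : T -> 'I_n -> T).

(** The state [s] carries what depends on the path and not on the node alone, such as a running
    maximum. It is updated on entering a child, so the initial state must already account for
    [t]. *)
Fixpoint expect (S : Type) (upd : S -> T -> S) (phi : S -> T -> R) N s t : R :=
  if N is N'.+1 then
    mean (fun i => expect upd phi N' (upd s (child t i)) (child t i))
  else phi s t.

(** The [N] generations summed begin with [t] itself and stop just before the leaves of [expect]. *)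
Fixpoint cumul (S : Type) (upd : S -> T -> S) (c : S -> T -> R) N s t : R :=
  if N is N'.+1 then
    c s t + mean (fun i => cumul upd c N' (upd s (child t i)) (child t i))
  else 0.

Lemma le_expect S (upd : S -> T -> S) phi psi N s t :
  (forall s t, phi s t <= psi s t) ->
  expect upd phi N s t <= expect upd psi N s t.
Proof. by move=> h; elim: N s t => //= N IH s t; exact: le_mean. Qed.

Variables F W : T -> R.
Hypothesis n0 : (0 < n)%N.
Hypothesis W0 : forall t, 0 <= W t.
Hypothesis meanW : forall t, mean (fun i => W (child t i)) = W t.
Hypothesis meanF : forall t, mean (fun i => F (child t i)) = F t.

Definition skip (s : unit) (t : T) : unit := tt.
Definition leafmean (phi : T -> R) N t := expect skip (fun=> phi) N tt t.
Definition nodesum (c : T -> R) N t := cumul skip (fun=> c) N tt t.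

Lemma leafmeanS phi N t : leafmean phi N.+1 t = mean (fun i => leafmean phi N (child t i)).
Proof. by []. Qed.

Lemma nodesumS c N t :
  nodesum c N.+1 t = c t + mean (fun i => nodesum c N (child t i)).
Proof. by []. Qed.

(** For [m = W t] this is the average over [t] of the [n]-adic maximal function of the weight,
    truncated after [N] generations. *)
Definition maxleaf N m t :=
  expect (fun m t => Num.max m (W t)) (fun m _ => m) N m t.

(** Up to the factor [18 * n], the coefficient that [drift_bound] produces; these are the terms of
    the Carleson sequence. *)
Definition sqrtgap t :=
  Num.sqrt (W t) * (Num.sqrt (W t) - mean (fun i => Num.sqrt (W (child t i)))).

(** For [F] and [W] the averages of [f] and [w], the mean over the interval of [t] of its squared
    martingale difference times [w]. *)
Definition sqvar t :=
  mean (fun i => (F (child t i) - F t) ^+ 2 * W (child t i)).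

(** Expanding the nonnegative mean of [(s i - r) ^+ 2] gives [2 * r * mean s <= 2 * r ^+ 2].
    Division by [r] leaves the case [r = 0], where all child weights vanish. *)
Lemma sqrt_concave t :
  mean (fun i => Num.sqrt (W (child t i))) <= Num.sqrt (W t).
Proof.
set r := Num.sqrt (W t); pose s i := Num.sqrt (W (child t i)).
have rW : r ^+ 2 = W t by rewrite sqr_sqrtr.
have r0 : 0 <= r by exact: sqrtr_ge0.
have [r0'|rn0] := eqVneq r 0.
  rewrite r0' (@eq_mean _ _ _ (fun=> 0)) ?mean_cst// => i.
  have H : W (child t i) <= n%:R * W t.
    by rewrite -(meanW t); apply: (@le_mean_term _ _ n0 (fun j => W (child t j)) i).
  have W00 : W t = 0 by rewrite -rW r0' expr0n.
  by apply/eqP; rewrite sqrtr_eq0; move: H; rewrite W00 mulr0.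
have rp : 0 < r by rewrite lt_def rn0.
have := @mean_ge0 _ _ (fun i => (s i - r) ^+ 2) (fun i => sqr_ge0 _).
rewrite (@eq_mean _ _ _ (fun i => (W (child t i) - (2 * r) * s i) + r ^+ 2)); last first.
  by move=> i; rewrite -[W (child t i)]sqr_sqrtr// /s; ring.
rewrite meanD (mean_cst n0) meanB meanZ meanW -rW -/s => H.
by rewrite -(ler_pM2l rp); lra.
Qed.

Lemma sqrtgap_ge0 t : 0 <= sqrtgap t.
Proof. by rewrite mulr_ge0 ?sqrtr_ge0// subr_ge0 sqrt_concave. Qed.

(* The potential [sqrt (m * W) - m], with [m] the running maximum, decreases on
   average by at least [sqrtgap] minus the mean growth of [m]. *)
Lemma nodesum_sqrtgap_le N m t : W t <= m ->
  nodesum sqrtgap N t <= Num.sqrt m * Num.sqrt (W t) - m + maxleaf N m t.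
Proof.
elim: N m t => [|N IH] m t Wm.
  by rewrite /= subrK mulr_ge0 ?sqrtr_ge0.
have m0 : 0 <= m by exact: le_trans (W0 t) Wm.
rewrite nodesumS /maxleaf /= -/(maxleaf _ _ _).
set r := Num.sqrt m.
have r0 : 0 <= r := sqrtr_ge0 m.
have step i : nodesum sqrtgap N (child t i) <=
    (r * Num.sqrt (W (child t i)) - m) +
    maxleaf N (Num.max m (W (child t i))) (child t i).
  apply: (le_trans (IH (Num.max m (W (child t i))) (child t i) _)).
    by rewrite le_max lexx orbT.
  (* If the child exceeds [m], the updated potential is 0, while the old expression is nonnegative
     because [Num.sqrt (W (child t i)) >= r]. *)
  rewrite lerD2r; case: (leP (W (child t i)) m) => // lt.
  have le2 : r <= Num.sqrt (W (child t i)) by rewrite ler_wsqrtr// ltW.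
  have sq := sqr_sqrtr (W0 (child t i)).
  have rq : r ^+ 2 = m by rewrite sqr_sqrtr.
  by rewrite -expr2 sq subrr -rq expr2 -mulrBr mulr_ge0// subr_ge0.
have := le_mean step.
rewrite meanD meanB meanZ (mean_cst n0) => H.
have Wr : Num.sqrt (W t) <= r by rewrite ler_wsqrtr.
have : sqrtgap t <= r * (Num.sqrt (W t) - mean (fun i => Num.sqrt (W (child t i)))).
  by rewrite ler_wpM2r// subr_ge0 sqrt_concave.
by move: H; rewrite /maxleaf; lra.
Qed.

Lemma sqvar_ge0 t : 0 <= sqvar t.
Proof. by apply: mean_ge0 => i; rewrite mulr_ge0 ?sqr_ge0. Qed.

Lemma nodesum_sqvar_ge0 N t : 0 <= nodesum sqvar N t.
Proof.
elim: N t => // N IH t.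
by rewrite nodesumS addr_ge0 ?sqvar_ge0 ?mean_ge0.
Qed.

(** With a positive weight, zero energy makes each child average equal its parent's, so [F] stays 0
    down the tree. This serves the case of an infinite characteristic. *)
Lemma leafmean_sq_eq0 N t : (forall t, 0 < W t) -> F t = 0 ->
  nodesum sqvar N t <= 0 -> leafmean (fun t => F t ^+ 2 * W t) N t = 0.
Proof.
move=> Wp; elim: N t => [|N IH] t F0; first by rewrite /leafmean /= F0 expr0n mul0r.
have m0 : 0 <= mean (fun i => nodesum sqvar N (child t i)).
  by apply: mean_ge0 => i; exact: nodesum_sqvar_ge0.
have v0 := sqvar_ge0 t.
rewrite nodesumS leafmeanS => H.
have mean_le0 (x : 'I_n -> R) i : (forall j, 0 <= x j) -> mean x <= 0 -> x i <= 0.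
  move=> x0 mx; apply: (le_trans (le_mean_term n0 i x0)).
  by rewrite mulr_ge0_le0.
rewrite (@eq_mean _ _ _ (fun=> 0)) ?mean_cst// => i; apply: IH.
  have /mean_le0-/(_ i) : sqvar t <= 0 by lra.
  rewrite F0 subr0 pmulr_lle0// => h; apply/eqP; rewrite -sqrf_eq0 eq_le sqr_ge0.
  by rewrite h// => j; rewrite mulr_ge0 ?sqr_ge0.
apply: (mean_le0 (fun i => nodesum sqvar N (child t i))); last lra.
by move=> j; exact: nodesum_sqvar_ge0.
Qed.

Variable A : R.
Hypothesis A0 : 0 < A.
Hypothesis maxleaf_le : forall N t, maxleaf N (W t) t <= A * W t.

(** The potential [sqrt (m * W) - m] vanishes when started at [m = W t]. *)
Lemma carleson_sqrtgap N t : nodesum sqrtgap N t <= A * W t.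
Proof.
apply: le_trans (maxleaf_le N t).
apply: (le_trans (@nodesum_sqrtgap_le N (W t) t (lexx _))).
by rewrite -expr2 sqr_sqrtr// subrr add0r.
Qed.

(* A state [(p, q)] records the running maxima of [F] and of [- F]. *)
Let upd (s : R * R) t : R * R := (Num.max s.1 (F t), Num.max s.2 (- F t)).
Let G (s : R * R) := s.1 ^+ 2 + s.2 ^+ 2.
(** With [s = (p, q)] this equals [4 * F ^ 2 + 2 * (p - F) ^ 2 + 2 * (q + F) ^ 2]. It dominates both
    [F ^ 2] and [G], and its increments are a square plus a predictable multiple of the martingale
    difference. *)
Let U (s : R * R) t := (2 * F t - s.1) ^+ 2 + (2 * F t + s.2) ^+ 2 + G s.
Let inv (s : R * R) t := [/\ 0 <= s.1, 0 <= s.2, F t <= s.1 & - F t <= s.2].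
Let tent N s t := cumul upd (fun s t => G s * sqrtgap t) N s t.
Let leafG N s t := expect upd (fun s t => G s * W t) N s t.
Let leafU N s t := expect upd (fun s t => U s t * W t) N s t.

Let inv_upd s t t' : inv s t -> inv (upd s t') t'.
Proof. by case=> p0 q0 _ _; split; rewrite /= !le_max ?p0 ?q0 ?lexx ?orbT. Qed.

Let G_upd s t t' : inv s t -> G s <= G (upd s t').
Proof.
move=> [p0 q0 _ _]; rewrite /G /=; apply: lerD; rewrite ler_sqr ?nnegrE ?le_max ?p0 ?q0//.
all: by rewrite lexx.
Qed.

(** Summation by parts: [G] only grows along a path, and each increment, born at some node,
    multiplies the Carleson sum below that node, which is at most [A * W] there. *)
Lemma carleson_embedding N s t : inv s t ->
  tent N s t <= A * leafG N s t.
Proof.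
(* The induction only compares the increments of [G] after [t], so the contribution of the initial
   value [G s] is removed from both sides. *)
move=> I; suff : tent N s t - G s * nodesum sqrtgap N t <=
    A * leafG N s t - A * (G s * W t).
  have : G s * nodesum sqrtgap N t <= G s * (A * W t).
    by rewrite ler_wpM2l ?carleson_sqrtgap// addr_ge0 ?sqr_ge0.
  lra.
elim: N s t I => [|N IH] s t I; first by rewrite /tent /leafG /nodesum /=; lra.
rewrite /tent /leafG nodesumS /= -/(tent _ _ _).
have step i : tent N (upd s (child t i)) (child t i) <=
   A * leafG N (upd s (child t i)) (child t i) +
   G s * (nodesum sqrtgap N (child t i) - A * W (child t i)).
  have H1 := IH _ _ (inv_upd (child t i) I).
  have : (G (upd s (child t i)) - G s) *
      (A * W (child t i) - nodesum sqrtgap N (child t i)) >= 0.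
    by rewrite mulr_ge0 ?subr_ge0 ?(G_upd _ I) ?carleson_sqrtgap.
  lra.
have := le_mean step.
by rewrite meanD !meanZ meanB meanZ meanW /leafG /tent /=; lra.
Qed.

(** If a maximum does not change, its part of the bound is an equality. If [F t'] is the new
    maximum, the bound exceeds the true value by [2 * (F t' - p) ^ 2]; likewise for [q]. *)
Let U_upd s t t' : F t <= s.1 -> - F t <= s.2 ->
  let d := F t' - F t in
  U (upd s t') t' <= U s t + 8 * d ^+ 2 +
     (4 * (2 * F t - s.1) + 4 * (2 * F t + s.2)) * d.
Proof.
move: s => [p q] /= Fp Fq; rewrite /U /G /upd/=.
have Hp : (2 * F t' - Num.max p (F t')) ^+ 2 + Num.max p (F t') ^+ 2 <=
   (2 * F t - p) ^+ 2 + p ^+ 2 + 4 * (F t' - F t) ^+ 2 +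
     4 * (2 * F t - p) * (F t' - F t).
  case: (leP p (F t')) => h; last by lra.
  have := sqr_ge0 (F t' - p); lra.
have Hq : (2 * F t' + Num.max q (- F t')) ^+ 2 + Num.max q (- F t') ^+ 2 <=
   (2 * F t + q) ^+ 2 + q ^+ 2 + 4 * (F t' - F t) ^+ 2 +
     4 * (2 * F t + q) * (F t' - F t).
  case: (leP q (- F t')) => h; last by lra.
  have := sqr_ge0 (F t' + q); lra.
lra.
Qed.

(** Each generation adds at most [8 * d ^ 2 + h * d] to [U]; [drift_bound] trades the linear term
    for energy and a tent term small enough to be absorbed later. *)
Let leafU_le N s t : inv s t ->
  leafU N s t <= U s t * W t +
    (8 + 36 * 72 * n%:R * A) * nodesum sqvar N t + (2 * A)^-1 * tent N s t.
Proof.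
(* Chosen so that [288 / (4 * l) * (18 * n) = (2 * A)^-1]. *)
set l := 36 * 72 * n%:R * A.
have n1 : 0 < n%:R :> R by rewrite ltr0n.
have l0 : 0 < l by rewrite /l !mulr_gt0.
elim: N s t => [|N IH] s t I.
  by rewrite /leafU /nodesum /tent/= !mulr0 !addr0.
rewrite /leafU nodesumS /tent /= -/(leafU _ _ _).
set h := 4 * (2 * F t - s.1) + 4 * (2 * F t + s.2).
pose d i := F (child t i) - F t.
have step i : leafU N (upd s (child t i)) (child t i) <=
   (U s t * W (child t i) + 8 * (d i ^+ 2 * W (child t i)) +
    h * (d i * W (child t i))) +
   ((8 + l) * nodesum sqvar N (child t i) +
   (2 * A)^-1 * tent N (upd s (child t i)) (child t i)).
  apply: (le_trans (IH _ _ (inv_upd (child t i) I))).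
  rewrite -addrA lerD2r.
  have -> : U s t * W (child t i) + 8 * (d i ^+ 2 * W (child t i)) +
    h * (d i * W (child t i)) =
    (U s t + 8 * d i ^+ 2 + h * d i) * W (child t i) by ring.
  by rewrite ler_wpM2r//; case: I => _ _ ? ?; exact: U_upd.
have := le_mean step.
rewrite !(meanD, meanZ) meanW -/(sqvar t).
have := @drift_bound R n n0 d (fun i => W (child t i)) h l (Num.sqrt (W t)) l0
  (sqrtr_ge0 _) (fun i => W0 _).
rewrite meanB meanF (mean_cst n0) subrr sqr_sqrtr// meanW => /(_ erefl erefl).
rewrite -/(sqvar t) -/(sqrtgap t).
(* From [- q <= F t <= p] follows that [h] is at most [12 * (p + q)] in absolute value, and [144 *
   (p + q) ^ 2 <= 288 * (p ^ 2 + q ^ 2)]. *)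
have h2 : h ^+ 2 <= 288 * G s.
  case: I; rewrite /h /G; case: (s) => p q /= p0 q0 Fp Fq.
  set k := (X in X ^+ 2 <= _).
  have : 0 <= (12 * (p + q) - k) * (12 * (p + q) + k).
    by rewrite /k mulr_ge0//; lra.
  have := sqr_ge0 (p - q); have := sqr_ge0 p; have := sqr_ge0 q; lra.
have : h ^+ 2 / (4 * l) * (18 * n%:R * sqrtgap t) <= (2 * A)^-1 * (G s * sqrtgap t).
  have -> : (2 * A)^-1 * (G s * sqrtgap t) =
     (288 * G s) / (4 * l) * (18 * n%:R * sqrtgap t).
    by rewrite /l; field; rewrite !gt_eqF.
  apply: ler_wpM2r; first by rewrite mulr_ge0 ?sqrtgap_ge0 ?mulr_ge0.
  by rewrite ler_wpM2r// invr_ge0 mulr_ge0// ltW.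
rewrite /tent /leafU.
set X := h ^+ 2 / (4 * l) * _.
set m1 := mean _; set m2 := mean _; set m3 := mean _; set m4 := mean _.
lra.
Qed.

(** By the embedding the tent term is at most half of [leafU] and is absorbed, while [U] vanishes at
    the starting node. This leaves [2 * (8 + 2592 * n * A)], at most [5200 * n * A] because
    [n * A >= 1], and [73 ^ 2 = 5329]. *)
Theorem square_function_tree N t : F t = 0 -> 1 <= A ->
  leafmean (fun t => F t ^+ 2 * W t) N t <= (73 ^+ 2 * n%:R * A) * nodesum sqvar N t.
Proof.
move=> F0 A1.
have n1 : 1 <= n%:R :> R by rewrite ler1n.
have I : inv (0, 0) t by split; rewrite //= F0 ?oppr0.
have leF : leafmean (fun t => F t ^+ 2 * W t) N t <= leafU N (0, 0) t.
  rewrite /leafmean; elim: N (0, 0) t {I F0} => [|N IH] s t /=.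
    rewrite ler_wpM2r// /U /G.
    have := sqr_ge0 (s.1 - F t); have := sqr_ge0 (2 * F t + s.2).
    have := sqr_ge0 s.2; nra.
  by apply: le_mean => i; exact: IH.
have GU : leafG N (0, 0) t <= leafU N (0, 0) t.
  by apply: le_expect => s t'; rewrite ler_wpM2r// lerDr addr_ge0 ?sqr_ge0.
have vs0 := nodesum_sqvar_ge0 N t.
have emb : (2 * A)^-1 * tent N (0, 0) t <= 2^-1 * leafU N (0, 0) t.
  have := carleson_embedding N I.
  rewrite -(ler_pM2l (_ : 0 < (2 * A)^-1)) ?invr_gt0 ?mulr_gt0//.
  have -> x : (2 * A)^-1 * (A * x) = 2^-1 * x by field; rewrite gt_eqF.
  lra.
have := leafU_le N I.
have -> : U (0, 0) t = 0 by rewrite /U /G /= F0; ring.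
have : nodesum sqvar N t <= n%:R * A * nodesum sqvar N t.
  by rewrite ler_peMl// mulr_ege1.
lra.
Qed.

End Tree.

(** * The grid and its averages *)

(* [locmax] is a supremum over uncountably many intervals; this lemma avoids
   having to prove that it is measurable. *)
Lemma le_integral_nonmeasurable d (T : measurableType d) (R : realType)
    (mu : {measure set T -> \bar R}) (D E : set T) (g h : T -> \bar R) :
  D `<=` E -> (forall x, D x -> (0 <= g x)%E) -> (forall x, E x -> (0 <= h x)%E) ->
  (forall x, D x -> (g x <= h x)%E) ->
  (\int[mu]_(x in D) g x <= \int[mu]_(x in E) h x)%E.
Proof.
move=> DE g0 h0 gh; rewrite integral_mkcond [leRHS]integral_mkcond.
have g0' x : (0 <= (g \_ D) x)%E by exact: erestrict_ge0.
have h0' x : (0 <= (h \_ E) x)%E by exact: erestrict_ge0.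
rewrite !ge0_integralTE//; apply: ereal_sup_le => _ [p /= pg <-].
exists p => //= x; apply: (le_trans (pg x)); rewrite /patch.
case: ifPn => [/set_mem Dx|_].
  by rewrite mem_set ?gh//; exact: DE.
by case: ifPn => // /set_mem; exact: h0.
Qed.

(** Telescoping by addition alone, so that it covers integrals valued in the extended reals. *)
Lemma sum_consecutive_itv (V : nmodType) (R : Type) (I : R -> R -> V)
    (x : nat -> R) m :
  (forall i, I (x i) (x i) = 0) ->
  (forall i, I (x 0%N) (x i.+1) = I (x 0%N) (x i) + I (x i) (x i.+1)) ->
  \sum_(i < m) I (x i) (x i.+1) = I (x 0%N) (x m).
Proof.
move=> I0 IS; elim: m => [|m IH]; first by rewrite big_ord0 I0.
by rewrite big_ord_recr/= IH IS.
Qed.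

Section Grid.
Variables (R : realType) (n : nat).
Hypothesis n2 : (2 <= n)%N.
Notation mu := (@lebesgue_measure R).

Let n0 : (0 < n)%N := ltnW n2.

Let pw_gt0 k : 0 < n%:R ^+ k :> R.
Proof. by rewrite exprn_gt0// ltr0n. Qed.

Definition grid_pt k j : R := j%:R / n%:R ^+ k.

Lemma pt_lt k i j : (grid_pt k i < grid_pt k j) = (i < j)%N.
Proof. by rewrite /grid_pt ltr_pM2r ?invr_gt0// ltr_nat. Qed.

Lemma pt_le k i j : (grid_pt k i <= grid_pt k j) = (i <= j)%N.
Proof. by rewrite /grid_pt ler_pM2r ?invr_gt0// ler_nat. Qed.

Lemma pt_refine k l j : grid_pt (k + l) (n ^ l * j) = grid_pt k j.
Proof.
rewrite /grid_pt exprD natrM natrX; field.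
by rewrite !gt_eqF.
Qed.

Lemma pt_child0 k j : grid_pt k.+1 (n * j) = grid_pt k j.
Proof. by rewrite -(pt_refine k 1) addn1 expn1. Qed.

Lemma pt_child1 k j : grid_pt k.+1 (n * j + n) = grid_pt k j.+1.
Proof. by rewrite -(pt_child0 k) mulnS addnC. Qed.

(* Half-open, so that the cells of a generation partition [0, 1[, whereas [nI]
   is closed. *)
Definition grid_cell k j : set R := `[grid_pt k j, grid_pt k j.+1[%classic.

Lemma measurable_cell k j : measurable (grid_cell k j).
Proof. exact: measurable_itv. Qed.

Lemma cellP k j x : grid_cell k j x <-> j%:R <= x * n%:R ^+ k < j.+1%:R.
Proof.
by rewrite /grid_cell /= in_itv /= /grid_pt ler_pdivrMr// ltr_pdivlMr.
Qed.

Lemma cell_inj k i j x : grid_cell k i x -> grid_cell k j x -> i = j.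
Proof.
move=> /cellP/andP[i1 i2] /cellP/andP[j1 j2]; apply/eqP.
rewrite eqn_leq -[(i <= j)%N]ltnS -[(j <= i)%N]ltnS -!(ltr_nat R).
by rewrite (le_lt_trans i1 j2) (le_lt_trans j1 i2).
Qed.

Lemma cell_exists k x : 0 <= x < 1 -> exists2 j, (j < n ^ k)%N & grid_cell k j x.
Proof.
move=> /andP[x0 x1]; have y0 : 0 <= x * n%:R ^+ k by rewrite mulr_ge0// ltW.
exists (Num.truncn (x * n%:R ^+ k)); last by apply/cellP; exact: truncn_itv.
have /andP[h _] := truncn_itv y0.
rewrite -(ltr_nat R) natrX (le_lt_trans h)//.
by rewrite -[ltRHS]mul1r ltr_pM2r.
Qed.

(** Both cells are written on the finer grid, where sharing a point becomes an inequality between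
    integers. *)
Lemma cell_sub_ancestor k l i j x : grid_cell k i x -> grid_cell (k + l) j x ->
  (n ^ l * i <= j)%N /\ (j.+1 <= n ^ l * i.+1)%N.
Proof.
rewrite /grid_cell -![grid_pt k _](pt_refine k l) /= !in_itv/= => /andP[h1 h2] /andP[h3 h4].
split; first by rewrite -ltnS -(pt_lt (k + l)) (le_lt_trans h1 h4).
by rewrite -(pt_lt (k + l)) (le_lt_trans h3 h2).
Qed.

Lemma cell_sub01 k j : (j < n ^ k)%N -> grid_cell k j `<=` `[0, 1].
Proof.
move=> jk x; rewrite /grid_cell /= !in_itv/= => /andP[h1 h2]; apply/andP; split.
  by apply: le_trans h1; rewrite divr_ge0// ltW.
apply/ltW/(lt_le_trans h2); rewrite /grid_pt ler_pdivrMr// mul1r -natrX ler_nat//.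
Qed.

Lemma measure_cell k j : mu (grid_cell k j) = ((n%:R ^+ k)^-1)%:E.
Proof.
rewrite /grid_cell lebesgue_measure_itv/= lte_fin pt_lt ltnS leqnn -EFinB.
by congr EFin; rewrite /grid_pt -mulrBl -natrB// subSnn mul1r.
Qed.

Lemma cell_split (V : nmodType) (I : R -> R -> V) k j :
  (forall a, I a a = 0) ->
  (forall a b c, a <= b -> b <= c -> I a c = I a b + I b c) ->
  I (grid_pt k j) (grid_pt k j.+1) =
  \sum_(i < n) I (grid_pt k.+1 (n * j + i)%N) (grid_pt k.+1 (n * j + i).+1).
Proof.
move=> I0 IS; pose x i := grid_pt k.+1 (n * j + i)%N.
have -> : grid_pt k j = x 0%N by rewrite /x addn0 pt_child0.
have -> : grid_pt k j.+1 = x n by rewrite /x pt_child1.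
rewrite -(@sum_consecutive_itv _ _ I x)//.
  by apply: eq_bigr => i _; rewrite /x addnS.
by move=> i; apply: IS; rewrite pt_le ?addn0 ?leq_addr ?addnS.
Qed.

Lemma ge0_integral_cell k j (g : R -> \bar R) :
  measurable_fun setT g -> (forall x, 0 <= g x)%E ->
  (\int[mu]_(x in grid_cell k j) g x =
   \sum_(i < n) \int[mu]_(x in grid_cell k.+1 (n * j + i)) g x)%E.
Proof.
move=> mg g0; apply: (@cell_split _ (fun a b => \int[mu]_(x in `[a, b[) g x)%E).
  by move=> a; rewrite set_itvE integral_set0.
move=> a b c ab bc; rewrite (@itv_bndbnd_setU _ _ _ (BLeft b)) ?bnd_simp//.
rewrite ge0_integral_setU//.
  exact: measurable_funS mg.
apply/disj_setPRL => z /= ; rewrite !in_itv/= => /andP[h _] /andP[_].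
by rewrite ltNge h.
Qed.

Lemma Rintegral_cell k j (g : R -> R) : mu.-integrable setT (EFin \o g) ->
  Rintegral mu (grid_cell k j) g =
  \sum_(i < n) Rintegral mu (grid_cell k.+1 (n * j + i)) g.
Proof.
move=> ig; apply: (@cell_split _ (fun a b => Rintegral mu `[a, b[ g)).
  by move=> a; rewrite set_itvE Rintegral_set0.
move=> a b c ab bc; rewrite (@itv_bndbnd_setU _ _ _ (BLeft b)) ?bnd_simp//.
rewrite Rintegral_setU//.
  by apply: integrableS ig => //; exact: measurableU.
apply/disj_setPRL => z /= ; rewrite !in_itv/= => /andP[h _] /andP[_].
by rewrite ltNge h.
Qed.

Lemma navgE k j (g : R -> R) : mu.-integrable setT (EFin \o g) ->
  navg n k j g = n%:R ^+ k * Rintegral mu (grid_cell k j) g.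
Proof.
move=> ig; rewrite /navg /avg /nleft /nright -/(grid_pt k j) -/(grid_pt k j.+1).
have -> : grid_pt k j.+1 - grid_pt k j = (n%:R ^+ k)^-1.
  by rewrite /grid_pt -mulrBl -natrB// subSnn mul1r.
rewrite invrK; congr (_ * _); rewrite /grid_cell Rintegral_itv_bndo_bndc//.
exact: integrableS ig.
Qed.

Lemma mean_navg k j (g : R -> R) : mu.-integrable setT (EFin \o g) ->
  mean (fun i : 'I_n => navg n k.+1 (n * j + i) g) = navg n k j g.
Proof.
move=> ig; rewrite /mean navgE// Rintegral_cell//.
under eq_bigr do rewrite navgE//.
rewrite -mulr_sumr mulrA exprS mulKf//.
by rewrite pnatr_eq0 -lt0n.
Qed.

Definition is_node (kj : nat * nat) : Prop := (kj.2 < n ^ kj.1)%N.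
Definition tree_node := {kj : nat * nat | is_node kj}.
Definition lvl (t : tree_node) := (sval t).1.
Definition pos (t : tree_node) := (sval t).2.

Lemma pos_lt t : (pos t < n ^ lvl t)%N.
Proof. exact: (svalP t). Qed.

Lemma child_subproof (t : tree_node) (i : 'I_n) :
  is_node ((lvl t).+1, n * pos t + i)%N.
Proof.
rewrite /is_node /= expnS (@leq_trans (n * (pos t).+1))//.
  by rewrite mulnS addnC ltn_add2r.
by rewrite leq_mul2l pos_lt orbT.
Qed.

Definition child t i : tree_node := exist is_node _ (child_subproof t i).

Lemma top_node_subproof : is_node (0%N, 0%N).
Proof. by []. Qed.

Definition top_node : tree_node := exist is_node _ top_node_subproof.

Definition scell t := grid_cell (lvl t) (pos t).

(** Extended values leave room for maximal and square functions whose integral may be infinite. *)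
Definition node_eavg (g : R -> \bar R) t : \bar R :=
  ((n%:R ^+ lvl t)%:E * \int[mu]_(x in scell t) g x)%E.

Lemma ea_child g t : measurable_fun setT g -> (forall x, 0 <= g x)%E ->
  (node_eavg g t = (n%:R^-1)%:E * \sum_(i < n) node_eavg g (child t i))%E.
Proof.
move=> mg g0; rewrite /node_eavg /scell ge0_integral_cell//=.
rewrite [in RHS](eq_bigr (fun i : 'I_n => (n%:R ^+ (lvl t).+1)%:E *
  \int[mu]_(x in grid_cell (lvl t).+1 (n * pos t + i)) g x)%E)//.
rewrite -ge0_sume_distrr; last by move=> i _; exact: integral_ge0.
rewrite muleA -EFinM exprS mulKf//.
by rewrite pnatr_eq0 -lt0n.
Qed.

Lemma mean_le_ea g t (x : 'I_n -> R) :
  measurable_fun setT g -> (forall x, 0 <= g x)%E ->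
  (forall i, (x i)%:E <= node_eavg g (child t i))%E -> ((mean x)%:E <= node_eavg g t)%E.
Proof.
move=> mg g0 H; rewrite ea_child// /mean EFinM -sumEFin.
by rewrite lee_wpmul2l ?lee_fin ?invr_ge0// lee_sum.
Qed.

Lemma mean_eq_ea g t (x : 'I_n -> R) :
  measurable_fun setT g -> (forall x, 0 <= g x)%E ->
  (forall i, node_eavg g (child t i) = (x i)%:E)%E -> (node_eavg g t = (mean x)%:E)%E.
Proof.
move=> mg g0 H; rewrite ea_child// /mean EFinM -sumEFin; congr (_ * _)%E.
by apply: eq_bigr => i _; exact: H.
Qed.

Lemma eaD g h t : measurable_fun setT g -> (forall x, 0 <= g x)%E ->
  measurable_fun setT h -> (forall x, 0 <= h x)%E ->
  node_eavg (fun x => g x + h x)%E t = (node_eavg g t + node_eavg h t)%E.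
Proof.
move=> mg g0 mh h0; rewrite /node_eavg ge0_integralD//; last 3 first.
- exact: measurable_cell.
- exact: measurable_funS mg.
- exact: measurable_funS mh.
by rewrite ge0_muleDr// integral_ge0.
Qed.

Lemma le_ea g h t : (forall x, 0 <= g x)%E -> (forall x, 0 <= h x)%E ->
  (forall x, scell t x -> g x <= h x)%E -> (node_eavg g t <= node_eavg h t)%E.
Proof.
move=> g0 h0 gh; rewrite lee_wpmul2l ?lee_fin ?(ltW (pw_gt0 _))//.
by apply: le_integral_nonmeasurable.
Qed.

Lemma ea_cst c t : (node_eavg (fun=> c%:E) t = c%:E)%E.
Proof.
rewrite /node_eavg /scell integral_cst; last exact: measurable_cell.
rewrite [X in (_ * (_ * X))%E](_ : _ = ((n%:R ^+ lvl t)^-1)%:E); last first.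
  exact: measure_cell.
by rewrite -!EFinM; congr EFin; rewrite mulrCA mulfV ?mulr1// gt_eqF.
Qed.

(** The closed intervals [nI] overlap at endpoints, so formulas for [Delta] are available on open
    cells only; the endpoints form a null set. *)
Lemma eq_ea_interior g h t : measurable_fun setT g -> measurable_fun setT h ->
  (forall x, grid_pt (lvl t) (pos t) < x < grid_pt (lvl t) (pos t).+1 -> g x = h x) ->
  node_eavg g t = node_eavg h t.
Proof.
move=> mg mh gh; rewrite /node_eavg /scell /grid_cell.
rewrite -!integral_itv_obnd_cbnd; [|exact: measurable_funS mh|exact: measurable_funS mg].
congr (_ * _)%E; apply: eq_integral => x; rewrite inE/= in_itv/=; exact: gh.
Qed.

End Grid.

(** * Tree sums as integrals of step functions *)

Section Steps.
Variables (R : realType) (n : nat).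
Hypothesis n2 : (2 <= n)%N.
Notation mu := (@lebesgue_measure R).
Notation pt := (@grid_pt R n).
Notation cell := (@grid_cell R n).
Notation node := (tree_node n).
Notation ea := (@node_eavg R n).

Definition node_avg (g : R -> R) (t : node) : R := navg n (lvl t) (pos t) g.

(** For [c j = navg n m j f] this is, on [0, 1[, the conditional expectation of [f] on generation
    [m]. *)
Definition step m (c : nat -> R) (x : R) : R :=
  \sum_(j < n ^ m) c j * \1_(cell m j) x.

Lemma stepE m c j x : (j < n ^ m)%N -> cell m j x -> step m c x = c j.
Proof.
move=> jm xj; rewrite /step (bigD1 (Ordinal jm))//= indicE mem_set// mulr1.
rewrite big1 ?addr0// => i /eqP ij; rewrite indicE memNset ?mulr0// => xi.
by apply: ij; apply/val_inj; exact: cell_inj xi xj.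
Qed.

Lemma step_ge0 m c x : (forall j, 0 <= c j) -> 0 <= step m c x.
Proof. by move=> c0; rewrite sumr_ge0// => j _; rewrite mulr_ge0// indicE. Qed.

Lemma measurable_step m c : measurable_fun setT (step m c).
Proof.
apply: measurable_sum => j; apply: measurable_funM => //.
by apply: measurable_indic; exact: measurable_cell.
Qed.

Variables (f w : R -> R).
Hypothesis intw : mu.-integrable setT (EFin \o w).
Hypothesis w0 : forall x, 0 <= w x.

Let F := node_avg f.
Let W := node_avg w.

Let mw : measurable_fun setT w.
Proof. by apply/measurable_EFinP; exact: measurable_int intw. Qed.

Lemma mean_node_avg g t : mu.-integrable setT (EFin \o g) ->
  mean (fun i => node_avg g (child t i)) = node_avg g t.
Proof. exact: mean_navg. Qed.

Lemma node_avg_ge0 t : 0 <= W t.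
Proof.
by rewrite /W /node_avg navgE// mulr_ge0 ?Rintegral_ge0// exprn_ge0.
Qed.

Lemma ea_weight c t : 0 <= c -> ea (fun x => (c * w x)%:E) t = (c * W t)%:E.
Proof.
move=> c0; rewrite /node_eavg /scell /W /node_avg navgE//.
under eq_integral do rewrite EFinM.
rewrite ge0_integralZl_EFin//; last 3 first.
- exact: measurable_cell.
- by move=> x _; rewrite lee_fin.
- by apply/measurable_EFinP; exact: measurable_funS mw.
rewrite /Rintegral !EFinM fineK; last first.
  apply: integrable_fin_num; first exact: measurable_cell.
  by apply: integrableS intw => //; exact: measurable_cell.
by rewrite muleCA.
Qed.

Definition sqstep m x : \bar R :=
  (step m (fun j => navg n m j f ^+ 2) x * w x)%:E.

Lemma measurable_sqstep m : measurable_fun setT (sqstep m).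
Proof.
apply/measurable_EFinP; apply: measurable_funM => //.
exact: measurable_step.
Qed.

Lemma sqstep_ge0 m x : (0 <= sqstep m x)%E.
Proof. by rewrite lee_fin mulr_ge0// step_ge0// => j; exact: sqr_ge0. Qed.

(** At depth 0 the step function is constant on the cell and only [w] gets averaged; deeper levels
    follow by averaging over children. *)
Lemma ea_sqstep N t :
  ea (sqstep (lvl t + N)) t =
  (leafmean (@child n) (fun t => F t ^+ 2 * W t) N t)%:E.
Proof.
elim: N t => [|N IH] t.
  rewrite /leafmean /= -ea_weight ?sqr_ge0// addn0 /node_eavg; congr (_ * _)%E.
  apply: eq_integral => x /set_mem xt.
  by rewrite /sqstep (stepE _ (pos_lt t)).
rewrite leafmeanS; apply: mean_eq_ea => //.
- exact: measurable_sqstep.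
- by move=> x; exact: sqstep_ge0.
by move=> i; rewrite -addSnnS -IH.
Qed.

Lemma indic_nI k j i x : pt k i < x < pt k i.+1 ->
  Defs.indic (nI n k j) x = (j == i)%:R.
Proof.
move=> /andP[h1 h2]; rewrite /Defs.indic /nI; case: asboolP => /=.
  rewrite in_itv/= -/(pt k j) -/(pt k j.+1) => /andP[h3 h4].
  suff -> : j = i by rewrite eqxx.
  apply/eqP; rewrite eqn_leq -[(i <= j)%N]ltnS -[(j <= i)%N]ltnS.
  by rewrite -!(pt_lt R n2 k) (le_lt_trans h3 h2) (lt_le_trans h1 h4).
move=> H; case: eqP => // ji; case: H; rewrite ji in_itv/=.
by rewrite (ltW h1) (ltW h2).
Qed.

Definition sqdiff l (x : R) : \bar R :=
  ((\sum_(j < n ^ l) (Delta n l j f x) ^+ 2)%:E * (w x)%:E)%E.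

Lemma measurable_Delta k j : measurable_fun setT (Delta n k j f).
Proof.
have E A : Defs.indic A = \1_A :> (R -> R).
  apply/funext => x; rewrite /Defs.indic indicE; case: asboolP => h.
    by rewrite mem_set.
  by rewrite memNset.
apply: measurable_funB.
  apply: measurable_sum => i; apply: measurable_funM => //.
  by rewrite E; apply: measurable_indic; exact: measurable_itv.
apply: measurable_funM => //.
by rewrite E; apply: measurable_indic; exact: measurable_itv.
Qed.

Lemma measurable_sqdiff l : measurable_fun setT (sqdiff l).
Proof.
apply: emeasurable_funM; last exact/measurable_EFinP.
apply/measurable_EFinP; apply: measurable_sum => j.
by apply: measurable_funX; exact: measurable_Delta.
Qed.

Lemma sqdiff_ge0 l x : (0 <= sqdiff l x)%E.
Proof.
rewrite /sqdiff -EFinM lee_fin mulr_ge0// sumr_ge0// => j _.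
exact: sqr_ge0.
Qed.

Lemma child_itv t (i : 'I_n) :
  pt (lvl t) (pos t) <= pt (lvl (child t i)) (pos (child t i)) /\
  pt (lvl (child t i)) (pos (child t i)).+1 <= pt (lvl t) (pos t).+1.
Proof.
rewrite -[lvl (child t i)]/(lvl t).+1 -[pos (child t i)]/(n * pos t + i)%N.
rewrite -(pt_child0 R n2 (lvl t) (pos t)) -(pt_child1 R n2 (lvl t) (pos t)) !pt_le//.
split; first by rewrite leq_addr.
by rewrite ltn_add2l.
Qed.

(** Inside a child of [t], among all intervals of the generation of [t] only [t] has a nonzero
    difference, and there it is the jump of the averages. *)
Lemma sqdiff_interior t (i : 'I_n) x :
  let c := child t i in pt (lvl c) (pos c) < x < pt (lvl c) (pos c).+1 ->
  sqdiff (lvl t) x = ((F (child t i) - F t) ^+ 2 * w x)%:E.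
Proof.
move=> c xc; rewrite /sqdiff -EFinM; congr (_ * _)%:E.
have xt : pt (lvl t) (pos t) < x < pt (lvl t) (pos t).+1.
  have [c1 c2] := child_itv t i; move: xc => /andP[h1 h2].
  by rewrite (le_lt_trans c1 h1) (lt_le_trans h2 c2).
rewrite (bigD1 (Ordinal (pos_lt t)))//= [X in _ + X]big1 ?addr0.
  rewrite /Delta (indic_nI _ xt) eqxx mulr1; congr ((_ - _) ^+ 2).
  rewrite (bigD1 i)//= (indic_nI _ xc) eqxx mulr1 big1 ?addr0// => i' /eqP ii'.
  rewrite (indic_nI _ xc) /pos /= eqn_add2l.
  by case: eqP => [/val_inj|]; rewrite ?mulr0.
move=> j /eqP jt; rewrite /Delta (indic_nI _ xt).
have jt' : (j == pos t :> nat) = false.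
  by apply/eqP => h; apply: jt; exact: val_inj.
rewrite jt' mulr0 subr0 big1 ?expr0n// => i' _.
rewrite (indic_nI _ xc); case: eqP => //; last by rewrite mulr0.
(* Division by [n] recovers the parent's index from the child's. *)
move=> /(congr1 (fun k => k %/ n)%N).
rewrite /pos /= ![(n * _)%N]mulnC !divnMDl ?(ltnW n2)// !divn_small// !addn0.
by move=> h; move: jt'; rewrite h eqxx.
Qed.

Definition psqdiff k N x := (\sum_(l < N) sqdiff (k + l) x)%E.

Lemma nodesum_sqvar_le N t :
  ((nodesum (@child n) (sqvar (@child n) F W) N t)%:E <= ea (psqdiff (lvl t) N) t)%E.
Proof.
have mps k M : measurable_fun setT (psqdiff k M).
  by apply: emeasurable_sum => l; exact: measurable_sqdiff.
have ps0 k M x : (0 <= psqdiff k M x)%E.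
  by apply: sume_ge0 => l _; exact: sqdiff_ge0.
elim: N t => [|N IH] t.
  rewrite /nodesum /= mule_ge0 ?lee_fin ?exprn_ge0// integral_ge0//.
rewrite nodesumS EFinD.
have -> : psqdiff (lvl t) N.+1 =
    (fun x => sqdiff (lvl t) x + psqdiff (lvl t).+1 N x)%E.
  apply/funext => x; rewrite /psqdiff big_ord_recl/= addn0; congr (_ + _)%E.
  by apply: eq_bigr => l _; rewrite addSnnS.
rewrite eaD//; last 2 first.
- exact: measurable_sqdiff.
- by move=> x; exact: sqdiff_ge0.
apply: leeD; last first.
  by apply: mean_le_ea => // i; exact: IH.
apply: mean_le_ea => //.
- exact: measurable_sqdiff.
- by move=> x; exact: sqdiff_ge0.
move=> i; rewrite -ea_weight ?sqr_ge0//.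
rewrite (@eq_ea_interior _ _ _ (sqdiff (lvl t)))//.
- by apply/measurable_EFinP; apply: measurable_funM.
- exact: measurable_sqdiff.
by move=> x /sqdiff_interior ->.
Qed.

(** [H] is any measurable majorant of the averages from generation [k0] on. The bound by [H] on the
    current cell survives the update of [m] because child cells are nested in it. *)
Lemma maxleaf_le_ea (H : R -> \bar R) k0 N m t :
  measurable_fun setT H -> (forall x, 0 <= H x)%E -> (k0 <= lvl t)%N ->
  (forall t' x, (k0 <= lvl t')%N -> scell t' x -> (W t')%:E <= H x)%E ->
  0 <= m -> (forall x, scell t x -> m%:E <= H x)%E ->
  ((maxleaf (@child n) W N m t)%:E <= ea H t)%E.
Proof.
move=> mH H0 + HW; elim: N m t => [|N IH] m t kt m0 mHt.
  rewrite -(ea_cst n2 m t); apply: le_ea => // x; rewrite lee_fin.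
apply: mean_le_ea => // i; apply: IH => /=.
- exact: leqW.
- by rewrite le_max m0.
move=> x xc; rewrite EFin_max ge_max; apply/andP; split; last first.
  by apply: HW => //; exact: leqW.
apply: mHt; move: xc; rewrite /scell /grid_cell /= !in_itv/= => /andP[h1 h2].
have [c1 c2] := child_itv t i.
by rewrite (le_trans c1 h1) (lt_le_trans h2 c2).
Qed.

End Steps.

(** * Lebesgue differentiation and the maximal function *)

Section Limit.
Variables (R : realType) (n : nat).
Hypothesis n2 : (2 <= n)%N.
Notation mu := (@lebesgue_measure R).
Notation pt := (@grid_pt R n).
Notation cell := (@grid_cell R n).
Notation node := (tree_node n).
Notation ea := (@node_eavg R n).

Let pw_gt0 k : 0 < n%:R ^+ k :> R.
Proof. by rewrite exprn_gt0// ltr0n ltnW. Qed.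

Let side m : {posnum R} := PosNum (divr_gt0 ltr01 (pw_gt0 m)).

Let side_gt0 m : 0 < (side m)%:num.
Proof. exact: divr_gt0. Qed.

(** Indexing by the floor gives a cell around every real point, as the differentiation theorem
    requires a family at all points; on [0, 1[ it is the grid cell. *)
Let acell (x : R) m : set R :=
  let z := Num.floor (x * n%:R ^+ m) in
  `[z%:~R / n%:R ^+ m, (z + 1)%:~R / n%:R ^+ m[%classic.

Let acell_self x m : acell x m x.
Proof.
rewrite /acell /= in_itv/= ler_pdivrMr// ltr_pdivlMr//.
by have /andP[-> ->] := floor_itv (x * n%:R ^+ m).
Qed.

Let acell_len (x : R) m : ((Num.floor (x * n%:R ^+ m) + 1)%:~R / n%:R ^+ m :> R) =
  (Num.floor (x * n%:R ^+ m))%:~R / n%:R ^+ m + (side m)%:num.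
Proof. by rewrite intrD mulrDl. Qed.

Let mu_acell x m : mu (acell x m) = ((side m)%:num)%:E.
Proof.
rewrite /acell lebesgue_measure_itv/= lte_fin acell_len ltrDl side_gt0.
by rewrite -EFinB addrAC subrr add0r.
Qed.

Let acell_nice x : nicely_shrinking x (acell x).
Proof.
split; first by move=> m; exact: measurable_itv.
(* A cell lies in the ball around any of its points with radius its length, and that ball has twice
   its measure. *)
exists (2, side); split => //=.
- under eq_fun do rewrite div1r -exprVn.
  apply: cvg_expr; rewrite ger0_norm ?invr_ge0//.
  by rewrite invf_lt1 ?ltr1n// ltr0n ltnW.
- move=> m y; have := acell_self x m; rewrite /acell/= !in_itv/= acell_len.
  rewrite /ball/= => /andP[h1 h2] /andP[h3 h4].
  rewrite ltr_distl; move: h1 h2 h3 h4.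
  set a := _ / _; set s := 1 / _; lra.
- move=> m; rewrite (lebesgue_measure_ball _ (ltW _)) ?side_gt0//.
  by rewrite mu_acell -EFinM lee_fin mulr_natl.
Qed.

Let acell_cell x m j : cell m j x -> acell x m = cell m j.
Proof.
move=> /(cellP n2) xj.
have fj : Num.floor (x * n%:R ^+ m) = j%:Z.
  by apply: floor_def; rewrite intrD -natrD addn1.
by rewrite /acell fj /grid_cell /grid_pt intrD -natrD addn1.
Qed.

Lemma ae_step_cvg (f : R -> R) : mu.-integrable setT (EFin \o f) ->
  {ae mu, forall x : R, 0 <= x < 1 ->
    (step n m (fun j => navg n m j f) x)%:E @[m --> \oo] --> (f x)%:E}.
Proof.
move=> intf.
have locf : locally_integrable setT f.
  by apply: open_integrable_locally => //; exact: openT.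
have := lebesgue_differentiation locf.
apply: (@filterS _ _ (ae_filter_ringOfSetsType mu)) => x fx x01.
have := nice_lebesgue_differentiation acell_nice locf fx.
apply: cvg_trans; apply: near_eq_cvg; apply: nearW => m.
have [j jm xj] := cell_exists n2 m x01.
rewrite (stepE n2 _ jm xj) (acell_cell xj) navgE// (measure_cell R n2).
rewrite inver gt_eqF ?invr_gt0// invrK EFinM /Rintegral fineK//.
apply: integrable_fin_num; first exact: measurable_cell.
by apply: integrableS intf => //; exact: measurable_cell.
Qed.

Lemma integral_sq_le_liminf (f w : R -> R) (K : \bar R) :
  mu.-integrable setT (EFin \o f) -> mu.-integrable setT (EFin \o w) ->
  (forall x, 0 <= w x) ->
  (forall m, \int[mu]_(x in `[0%R, 1%R[) sqstep n f w m x <= K)%E ->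
  (\int[mu]_(x in `[0%R, 1%R[) (f x ^+ 2 * w x)%:E <= K)%E.
Proof.
move=> intf intw w0 bd.
have mw : measurable_fun setT w.
  by apply/measurable_EFinP; exact: measurable_int intw.
have mf : measurable_fun setT f.
  by apply/measurable_EFinP; exact: measurable_int intf.
have [N [mN N0 subN]] := ae_step_cvg intf.
have mfw : measurable_fun setT (fun x => (f x ^+ 2 * w x)%:E).
  apply/measurable_EFinP; apply: measurable_funM => //.
  exact: measurable_funX.
rewrite (ge0_negligible_integral _ _ _ _ N0)//; last 2 first.
- exact: measurable_funS mfw.
- by move=> x _; rewrite lee_fin mulr_ge0 ?sqr_ge0.
have mD : measurable (`[0%R, 1%R[%classic `\` N : set R).
  by apply: measurableD.
have msq m : measurable_fun setT (sqstep n f w m).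
  exact: measurable_sqstep.
apply: (@le_trans _ _ (\int[mu]_(x in `[0%R, 1%R[ `\` N)
    limn_einf (fun m => sqstep n f w m x))%E); last first.
  apply: (le_trans (fatou _ _ _ _)) => //.
  - by move=> m; exact: measurable_funS (msq m).
  - by move=> m x _; exact: sqstep_ge0.
  rewrite limn_einf_lim; apply: lime_le; first exact: is_cvg_einfs.
  apply: nearW => m; apply: (le_trans _ (bd m)).
  apply: (@le_trans _ _ (\int[mu]_(x in `[0%R, 1%R[ `\` N) sqstep n f w m x)%E).
    by apply: ereal_inf_lbound; exists m => /=.
  apply: le_integral_nonmeasurable => //.
  - by move=> x _; exact: sqstep_ge0.
  - by move=> x _; exact: sqstep_ge0.
rewrite le_eqVlt; apply/orP; left; apply/eqP/eq_integral => x /set_mem[/=]; rewrite in_itv/= => x01 Nx.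
have cv : (step n m (fun j => navg n m j f) x)%:E @[m --> \oo] --> (f x)%:E.
  by apply: contrapT => h; apply: Nx; apply: subN => /=; apply/not_implyP.
suff : sqstep n f w m x @[m --> \oo] --> (f x ^+ 2 * w x)%:E.
  by move=> /cvg_limn_einf_sup[-> _].
(* Exactly one cell of each generation contains [x], so squaring the coefficients squares the step
   function. *)
have -> : (fun m => sqstep n f w m x) = (fun m =>
    (step n m (fun j => navg n m j f) x)%:E *
    (step n m (fun j => navg n m j f) x)%:E * (w x)%:E)%E.
  apply/funext => m; rewrite /sqstep.
  have [j jm xj] := cell_exists n2 m x01.
  by rewrite !(stepE n2 _ jm xj) -!EFinM expr2.
rewrite expr2 !EFinM; apply: cvgeM => //; last exact: cvg_cst.
by apply: cvgeM.
Qed.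

End Limit.

(** * Comparison of the [n]-adic and the localized maximal functions *)

Section Maximal.
Variables (R : realType) (n : nat).
Hypothesis n2 : (2 <= n)%N.
Notation mu := (@lebesgue_measure R).
Notation pt := (@grid_pt R n).
Notation cell := (@grid_cell R n).
Notation node := (tree_node n).
Variable w : R -> R.
Hypothesis intw : mu.-integrable setT (EFin \o w).
Hypothesis w0 : forall x, 0 <= w x.

Let W : node -> R := node_avg w.

(** A countable supremum over generations from [k0] on, hence measurable; starting at [k0] keeps the
    competing cells inside the current one. *)
Definition nadic_max k0 (x : R) : \bar R :=
  esups (fun l => (step n l (fun j => navg n l j w) x)%:E) k0.

Let navg_ge0 k j : 0 <= navg n k j w.
Proof. by rewrite navgE// mulr_ge0 ?Rintegral_ge0// exprn_ge0. Qed.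

Lemma measurable_nadic_max k0 : measurable_fun setT (nadic_max k0).
Proof.
apply: measurable_fun_esups => l; apply/measurable_EFinP.
exact: measurable_step.
Qed.

Lemma nadic_max_ge0 k0 x : (0 <= nadic_max k0 x)%E.
Proof.
apply: le_trans (ereal_sup_ubound _); last by exists k0 => //=.
by rewrite lee_fin step_ge0.
Qed.

Lemma le_nadic_max k0 t x : (k0 <= lvl t)%N -> scell t x ->
  ((W t)%:E <= nadic_max k0 x)%E.
Proof.
move=> kt xt; apply: ereal_sup_ubound; exists (lvl t) => //=.
by rewrite (stepE n2 _ (pos_lt t) xt).
Qed.

Lemma locmax_ge0 (c d : R) (g : R -> R) (x : R) : c < d -> (0 <= locmax c d g x)%E.
Proof.
move=> cd; rewrite /locmax; case: asboolP => // /=; rewrite in_itv/= => /andP[h1 h2].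
(* The whole interval competes, so the supremum is not over the empty set, where it would be
   [-oo]. *)
apply: (@le_trans _ _ (`|avg c d g|)%:E); first by rewrite lee_fin.
by apply: ereal_sup_ubound; exists c, d.
Qed.

Lemma nadic_max_le_locmax (t : node) x : scell t x ->
  (nadic_max (lvl t) x <=
   locmax (pt (lvl t) (pos t)) (pt (lvl t) (pos t).+1) w x)%E.
Proof.
move=> xt; apply: ge_ereal_sup => _ [l /= tl <-].
have x01 : 0 <= x < 1.
  move: xt => /[dup] /(cell_sub01 n2 (pos_lt t)) /=; rewrite in_itv/= => /andP[-> _].
  rewrite /scell /grid_cell/= in_itv/= => /andP[_ h].
  apply: (lt_le_trans h).
  rewrite /grid_pt ler_pdivrMr ?exprn_gt0 ?ltr0n ?(ltnW n2)//.
  by rewrite mul1r -natrX ler_nat pos_lt.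
have [j jl xj] := cell_exists n2 l x01.
rewrite (stepE n2 _ jl xj).
have xt' := xt.
move: xt; rewrite {1}/scell /grid_cell /= in_itv/= => /andP[t1 t2].
rewrite /locmax asboolT/=; last by rewrite in_itv/= t1 ltW.
apply: ereal_sup_ubound; exists (pt l j), (pt l j.+1).
split; last by rewrite /navg ger0_norm// navg_ge0.
have xj' := xj.
move: xj; rewrite {1}/grid_cell /= in_itv/= => /andP[j1 j2].
have [d ld] : exists d, l = (lvl t + d)%N by exists (l - lvl t)%N; rewrite subnKC.
subst l; have [s1 s2] := cell_sub_ancestor n2 xt' xj'.
split => //.
- by rewrite pt_lt.
- by rewrite -(pt_refine R n2 (lvl t) d) pt_le.
- exact: ltW.
- by rewrite -(pt_refine R n2 (lvl t) d) pt_le.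
Qed.

(** The measurable [nadic_max] is interposed: the induction on the tree uses it, and [locmax] enters
    only through a pointwise comparison at the end. *)
Lemma maxleaf_le_locmax N t :
  ((maxleaf (@child n) W N (W t) t)%:E <=
   eavg (pt (lvl t) (pos t)) (pt (lvl t) (pos t).+1)
     (locmax (pt (lvl t) (pos t)) (pt (lvl t) (pos t).+1) w))%E.
Proof.
have W0 : 0 <= W t by exact: navg_ge0.
apply: (le_trans (@maxleaf_le_ea _ _ n2 w (nadic_max (lvl t)) (lvl t) N (W t) t
  _ _ _ _ _ _)) => //.
- exact: measurable_nadic_max.
- by move=> x; exact: nadic_max_ge0.
- by move=> t' x; exact: le_nadic_max.
- by move=> x; exact: le_nadic_max.
rewrite /eavg.
have -> : pt (lvl t) (pos t).+1 - pt (lvl t) (pos t) = (n%:R ^+ lvl t)^-1.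
  by rewrite /grid_pt -mulrBl -natrB// subSnn mul1r.
rewrite invrK lee_wpmul2l ?lee_fin ?exprn_ge0//.
apply: le_integral_nonmeasurable.
- move=> x; rewrite /scell /grid_cell /= !in_itv/= => /andP[h1 h2].
  by rewrite h1 ltW.
- by move=> x _; exact: nadic_max_ge0.
- by move=> x _; apply: locmax_ge0; rewrite pt_lt.
- by move=> x; exact: nadic_max_le_locmax.
Qed.

End Maximal.

(** * The weighted inequality *)

Section Core.
Variables (R : realType) (n : nat).
Hypothesis n2 : (2 <= n)%N.
Notation mu := (@lebesgue_measure R).
Notation pt := (@grid_pt R n).
Notation node := (tree_node n).
Notation ea := (@node_eavg R n).
Variables (f w : R -> R).
Hypothesis intf : mu.-integrable setT (EFin \o f).
Hypothesis intw : mu.-integrable setT (EFin \o w).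
Hypothesis w0 : forall x, 0 <= w x.
Hypothesis W_gt0 : forall t : node, 0 < node_avg w t.
Hypothesis f_root : node_avg f (top_node n) = 0.

Let n0 : (0 < n)%N := ltnW n2.

Lemma ea_root g : ea g (top_node n) = (\int[mu]_(x in `[0%R, 1%R[) g x)%E.
Proof.
rewrite /node_eavg /scell /grid_cell /grid_pt /lvl /pos /= expr0 mul1e.
by rewrite !divr1.
Qed.

Lemma measurable_Ssq : measurable_fun setT (Ssq n f).
Proof.
apply: ge0_emeasurable_sum => k.
  by move=> x _ _; rewrite lee_fin sumr_ge0// => j _; exact: sqr_ge0.
move=> _; apply/measurable_EFinP; apply: measurable_sum => j.
by apply: measurable_funX; exact: measurable_Delta.
Qed.

Lemma Ssq_ge0 x : (0 <= Ssq n f x)%E.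
Proof.
apply: nneseries_ge0 => k _ _; rewrite lee_fin sumr_ge0// => j _.
exact: sqr_ge0.
Qed.

Lemma psqdiff_le_Ssq N x : (psqdiff n f w 0 N x <= Ssq n f x * (w x)%:E)%E.
Proof.
rewrite /psqdiff /sqdiff -ge0_sume_distrl; last first.
  by move=> l _; rewrite lee_fin sumr_ge0// => j _; exact: sqr_ge0.
rewrite lee_wpmul2r ?lee_fin// -(big_mkord xpredT (fun l =>
  (\sum_(j < n ^ l) Delta n l j f x ^+ 2)%:E)).
apply: nneseries_lim_ge => k _ _.
by rewrite lee_fin sumr_ge0// => j _; exact: sqr_ge0.
Qed.

Lemma nodesum_sqvar_le_Ssq N :
  ((nodesum (@child n) (sqvar (@child n) (node_avg f) (node_avg w)) N (top_node n))%:E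
   <= \int[mu]_(x in `[0%R, 1%R[) (Ssq n f x * (w x)%:E))%E.
Proof.
apply: (le_trans (nodesum_sqvar_le n2 f intw w0 N (top_node n))).
rewrite -ea_root; apply: le_ea => //.
- by move=> x; apply: sume_ge0 => l _; exact: sqdiff_ge0.
- by move=> x; rewrite mule_ge0 ?Ssq_ge0 ?lee_fin.
- by move=> x _; exact: psqdiff_le_Ssq.
Qed.

Lemma integral_sq_le_leafmean (K : \bar R) :
  (forall N, (leafmean (@child n)
     (fun t => node_avg f t ^+ 2 * node_avg w t) N (top_node n))%:E <= K)%E ->
  (\int[mu]_(x in `[0%R, 1%R[) (f x ^+ 2 * w x)%:E <= K)%E.
Proof.
move=> bd; apply: (integral_sq_le_liminf n2 intf intw w0) => m.
by rewrite -ea_root -[m]add0n (ea_sqstep n2 f intw w0 m (top_node n)).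
Qed.

Lemma integral_sq_le_Ssq (A : R) :
  (forall t : node, eavg (pt (lvl t) (pos t)) (pt (lvl t) (pos t).+1)
     (locmax (pt (lvl t) (pos t)) (pt (lvl t) (pos t).+1) w)
     <= (A * node_avg w t)%:E)%E ->
  (\int[mu]_(x in `[0%R, 1%R[) (f x ^+ 2 * w x)%:E <=
   (73 ^+ 2 * n%:R * A)%:E *
   \int[mu]_(x in `[0%R, 1%R[) (Ssq n f x * (w x)%:E))%E.
Proof.
move=> hA.
have hM N t : maxleaf (@child n) (node_avg w) N (node_avg w t) t <= A * node_avg w t.
  by rewrite -lee_fin; apply: (le_trans _ (hA t)); exact: maxleaf_le_locmax.
(* At depth 0 [maxleaf] is the weight average itself, so the bound at the root forces [A >= 1]. *)
have A1 : 1 <= A.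
  by rewrite -(ler_pM2r (W_gt0 (top_node n))) mul1r; exact: (hM 0%N).
have A0 : 0 < A by rewrite (lt_le_trans ltr01).
apply: integral_sq_le_leafmean => N.
apply: (@le_trans _ _ ((73 ^+ 2 * n%:R * A)%:E * (nodesum (@child n)
  (sqvar (@child n) (node_avg f) (node_avg w)) N (top_node n))%:E)%E).
  rewrite -EFinM lee_fin; apply: square_function_tree => //.
  - by move=> t; rewrite ltW.
  - by move=> t; exact: mean_node_avg.
  - by move=> t; exact: mean_node_avg.
rewrite lee_wpmul2l ?nodesum_sqvar_le_Ssq// lee_fin.
by rewrite mulr_ge0 ?mulr_ge0// ?exprn_ge0// ltW.
Qed.

(** Needed when the characteristic is [+oo]: then [+oo * 0 = 0] on the right, and the left side must
    vanish as well. *)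
Lemma integral_sq_eq0 :
  (\int[mu]_(x in `[0%R, 1%R[) (Ssq n f x * (w x)%:E) = 0 ->
   \int[mu]_(x in `[0%R, 1%R[) (f x ^+ 2 * w x)%:E <= 0)%E.
Proof.
move=> S0; apply: integral_sq_le_leafmean => N; rewrite lee_fin.
rewrite leafmean_sq_eq0//.
- by move=> t; rewrite ltW.
- by rewrite -lee_fin; apply: (le_trans (nodesum_sqvar_le_Ssq N)); rewrite S0.
Qed.

End Core.

(** * Passage from data on [0, 1] to integrable functions on the line *)

Section Transfer.
Variables (R : realType) (n : nat).
Hypothesis n2 : (2 <= n)%N.
Notation mu := (@lebesgue_measure R).
Notation I := (`[0%R, 1%R]%classic : set R).
Notation pt := (@grid_pt R n).
Notation node := (tree_node n).

Lemma integrable_patch (g : R -> R) :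
  mu.-integrable I (EFin \o g) -> mu.-integrable setT (EFin \o (g \_ I)).
Proof.
move=> ig; rewrite -restrict_EFin; apply/integrable_restrict => //=.
by rewrite setTI.
Qed.

Lemma itv_sub01 (a b : R) : 0 <= a -> b <= 1 -> `[a, b]%classic `<=` I.
Proof.
move=> a0 b1 x /=; rewrite !in_itv/= => /andP[ax xb].
by rewrite (le_trans a0 ax) (le_trans xb b1).
Qed.

Lemma avg_ae_eq (a b : R) (g h : R -> R) : 0 <= a -> b <= 1 ->
  mu.-integrable I (EFin \o g) -> mu.-integrable I (EFin \o h) ->
  {ae mu, forall x, I x -> g x = h x} -> avg a b g = avg a b h.
Proof.
move=> a0 b1 ig ih gh; rewrite /avg /Rintegral; congr (_ * fine _).
have sub := itv_sub01 a0 b1.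
apply: ae_eq_integral.
- exact: measurable_itv.
- by apply: measurable_funS (measurable_int _ ig); first exact: measurable_itv.
- by apply: measurable_funS (measurable_int _ ih); first exact: measurable_itv.
apply: (@filterS _ _ (ae_filter_ringOfSetsType mu)) gh => x gh xab.
by rewrite /= gh//; exact: sub.
Qed.

Lemma pt_ge0 k j : 0 <= pt k j.
Proof. by rewrite /grid_pt divr_ge0// exprn_ge0. Qed.

Lemma pt_le1 k j : (j < n ^ k)%N -> pt k j.+1 <= 1.
Proof.
move=> jk; rewrite /grid_pt ler_pdivrMr ?exprn_gt0 ?ltr0n ?(ltnW n2)//.
by rewrite mul1r -natrX ler_nat.
Qed.

Section Pair.
Variables f w f1 w1 : R -> R.
Hypothesis intf : mu.-integrable I (EFin \o f).
Hypothesis intw : mu.-integrable I (EFin \o w).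
Hypothesis intf1 : mu.-integrable setT (EFin \o f1).
Hypothesis intw1 : mu.-integrable setT (EFin \o w1).
Hypothesis f1E : forall x, I x -> f1 x = f x.
Hypothesis w1E : {ae mu, forall x, I x -> w1 x = w x}.

Let mI : measurable (I : set R). Proof. exact: measurable_itv. Qed.

Lemma avg_f1 (a b : R) : 0 <= a -> b <= 1 -> avg a b f1 = avg a b f.
Proof.
move=> a0 b1; apply: avg_ae_eq => //; first exact: integrableS intf1.
by apply: (aeW mu) => x; exact: f1E.
Qed.

Lemma avg_w1 (a b : R) : 0 <= a -> b <= 1 -> avg a b w1 = avg a b w.
Proof. by move=> a0 b1; apply: avg_ae_eq => //; exact: integrableS intw1. Qed.

Lemma Delta_f1 k j x : (j < n ^ k)%N -> Delta n k j f1 x = Delta n k j f x.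
Proof.
move=> jk; rewrite /Delta; congr (_ - _).
  apply: eq_bigr => i _; congr (_ * _); apply: avg_f1; first exact: pt_ge0.
  exact: pt_le1 (child_subproof (exist (is_node n) (k, j) jk) i).
by congr (_ * _); apply: avg_f1; [exact: pt_ge0|exact: pt_le1].
Qed.

Lemma Ssq_f1 x : Ssq n f1 x = Ssq n f x.
Proof.
apply: eq_eseriesr => k _; congr EFin; apply: eq_bigr => j _.
by rewrite Delta_f1.
Qed.

Lemma node_avg_w1 (t : node) : node_avg w1 t = navg n (lvl t) (pos t) w.
Proof. by apply: avg_w1; [exact: pt_ge0|exact: pt_le1 (pos_lt t)]. Qed.

(** Only averages over subintervals enter, so a change of the weight on a null set leaves the
    maximal function the same at every point. *)
Lemma locmax_w1 (c d : R) x : 0 <= c -> d <= 1 ->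
  locmax c d w1 x = locmax c d w x.
Proof.
move=> c0 d1; rewrite /locmax; case: asboolP => // _; congr ereal_sup.
apply/seteqP; split=> y [a [b [[ab ca ax xb bd] ->]]]; exists a, b; split => //;
  by rewrite avg_w1// ?(le_trans c0 ca)// (le_trans bd d1).
Qed.

Lemma integral_w1 (g : R -> \bar R) : measurable_fun setT g ->
  (\int[mu]_(x in `[0%R, 1%R[) (g x * (w1 x)%:E) =
   \int[mu]_(x in I) (g x * (w x)%:E))%E.
Proof.
move=> mg.
have mgw : measurable_fun setT (fun x => g x * (w1 x)%:E)%E.
  by apply: emeasurable_funM => //; exact: measurable_int intw1.
rewrite integral_itv_bndo_bndc; last exact: measurable_funS mgw.
apply: ae_eq_integral.
- exact: measurable_itv.
- by apply: measurable_funS mgw.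
- apply: emeasurable_funM; first exact: measurable_funS mg.
  exact: measurable_int intw.
apply: (@filterS _ _ (ae_filter_ringOfSetsType mu)) w1E => x h xI.
by rewrite h.
Qed.

End Pair.

(** A zero average would make [w] vanish almost everywhere on the cell, where it is almost
    everywhere positive; the cell would then be null, against its positive length. *)
Lemma node_avg_gt0 (w : R -> R) (t : node) :
  mu.-integrable setT (EFin \o w) -> (forall x, 0 <= w x) ->
  {ae mu, forall x, I x -> 0 < w x} -> 0 < node_avg w t.
Proof.
move=> intw w0 wp; rewrite lt_def node_avg_ge0// andbT.
apply/eqP; rewrite /node_avg navgE// => /eqP; rewrite mulf_eq0.
rewrite gt_eqF ?exprn_gt0 ?ltr0n ?(ltnW n2)//= => /eqP W0.
have mc : measurable (@grid_cell R n (lvl t) (pos t)) by exact: measurable_cell.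
have intc : mu.-integrable (@grid_cell R n (lvl t) (pos t)) (EFin \o w).
  exact: integrableS intw.
have : (\int[mu]_(x in @grid_cell R n (lvl t) (pos t)) `|(w x)%:E| = 0)%E.
  under eq_integral do rewrite gee0_abs ?lee_fin//.
  rewrite -[LHS]fineK; first by rewrite -[fine _]/(Rintegral mu _ w) W0.
  exact: integrable_fin_num.
move=> /(ae_eq_integral_abs mu mc (measurable_int _ intc)) wz.
have : mu.-negligible (@grid_cell R n (lvl t) (pos t)).
  have := @filterI _ _ (ae_filter_ringOfSetsType mu) _ _ wz wp.
  apply: negligibleS => x xc /= [h1 h2].
  have := h2 (cell_sub01 n2 (pos_lt t) xc).
  by have [->] := h1 xc; rewrite ltxx.
move=> neg; have : mu (@grid_cell R n (lvl t) (pos t)) == 0%E.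
  by apply/eqP; apply: (measure_negligible _ neg); exact: measurable_cell.
apply/negP.
rewrite [X in X == _](_ : _ = ((n%:R ^+ lvl t)^-1)%:E); last exact: measure_cell.
by rewrite gt_eqF// lte_fin invr_gt0 exprn_gt0// ltr0n ltnW.
Qed.

End Transfer.

Theorem theorem3p4 (R : realType) :
  exists C : R, forall (n : nat) (w f : R -> R),
    (2 <= n)%N ->
    is_weight w ->
    measurable_fun `[0%R : R, 1%R] f ->
    (\int[(@lebesgue_measure R)]_(x in `[0%R : R, 1%R]) ((f x) ^+ 2 * w x)%:E < +oo)%E ->
    (@lebesgue_measure R).-integrable `[0%R : R, 1%R] (EFin \o f) ->
    (\int[(@lebesgue_measure R)]_(x in `[0%R : R, 1%R]) (f x)%:E = 0)%E ->
    (L2w w f <= (C * n%:R)%:E * sqrte (Ainf_scl n w) * SfL2w n w f)%E.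
Proof.
(* The square root of the constant in [square_function_tree]. *)
exists 73 => n w f n2 [intw wp] _ _ intf f_mean0.
pose mu := @lebesgue_measure R.
pose I : set R := `[0%R, 1%R]%classic.
have mI : measurable I by exact: measurable_itv.
pose f1 : R -> R := f \_ I.
(* The absolute value makes the weight nonnegative at every point and changes it on a null set of
   [0, 1] only. *)
pose w1 : R -> R := (fun x => `|w x|) \_ I.
have intf1 : mu.-integrable setT (EFin \o f1) by exact: integrable_patch.
have intw1 : mu.-integrable setT (EFin \o w1).
  by apply: integrable_patch; exact: integrable_norm.
have f1E x : I x -> f1 x = f x by move=> Ix; rewrite /f1 patchE mem_set.
have w1E : {ae mu, forall x, I x -> w1 x = w x}.
  apply: (@filterS _ _ (ae_filter_ringOfSetsType mu)) wp => x wx Ix.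
  by rewrite /w1 patchE mem_set// gtr0_norm// wx.
have w10 x : 0 <= w1 x by rewrite /w1 patchE; case: ifPn.
have W_gt0 (t : tree_node n) : 0 < node_avg w1 t.
  apply: node_avg_gt0 => //.
  apply: (@filterS2 _ _ (ae_filter_ringOfSetsType mu) _ _ _ _ w1E wp) => x h1 h2 Ix.
  by rewrite h1// h2.
have f_root : node_avg f1 (top_node n) = 0.
  rewrite /node_avg /navg (avg_f1 intf)//; last 2 first.
  - exact: pt_ge0.
  - exact: pt_le1.
  by rewrite /avg /nleft /nright expr0 !divr1 /Rintegral f_mean0 mulr0.
have W_E (t : tree_node n) := node_avg_w1 n2 intw intw1 w1E t.
set S := (\int[mu]_(x in `[0%R, 1%R]) (Ssq n f x * (w x)%:E))%E.
have S1 : (\int[mu]_(x in `[0%R, 1%R[) (Ssq n f1 x * (w1 x)%:E) = S)%E.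
  rewrite (integral_w1 intw intw1 w1E); last exact: measurable_Ssq.
  by apply: eq_integral => x _; rewrite (Ssq_f1 n2 intf intf1 f1E).
have S0 : (0 <= S)%E.
  rewrite -S1; apply: integral_ge0 => x _.
  by rewrite mule_ge0 ?Ssq_ge0 ?lee_fin.
set X := (\int[mu]_(x in `[0%R, 1%R]) (f x ^+ 2 * w x)%:E)%E.
have X1 : (\int[mu]_(x in `[0%R, 1%R[) (f1 x ^+ 2 * w1 x)%:E = X)%E.
  under eq_integral do rewrite EFinM.
  rewrite (integral_w1 intw intw1 w1E (g := fun x => (f1 x ^+ 2)%:E)); last first.
    apply/measurable_EFinP; apply: measurable_funX.
    by apply/measurable_EFinP; exact: measurable_int intf1.
  by apply: eq_integral => x /set_mem xI; rewrite -EFinM f1E.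
have ratio_ge0 (t : tree_node n) : (0 <= eavg (nleft R n (lvl t) (pos t))
    (nright R n (lvl t) (pos t)) (locmax (nleft R n (lvl t) (pos t))
    (nright R n (lvl t) (pos t)) w))%E.
  rewrite /eavg mule_ge0 ?lee_fin ?invr_ge0 ?subr_ge0 ?(pt_le R n2)//.
  apply: integral_ge0 => x _; apply: locmax_ge0.
  by rewrite (pt_lt R n2).
have ratio_le (t : tree_node n) : (eavg (nleft R n (lvl t) (pos t))
    (nright R n (lvl t) (pos t)) (locmax (nleft R n (lvl t) (pos t))
    (nright R n (lvl t) (pos t)) w) * ((navg n (lvl t) (pos t) w)^-1)%:E <=
    Ainf_scl n w)%E.
  by apply: ereal_sup_ubound; exists (lvl t), (pos t); split => //; exact: pos_lt.
have A0 : (0 <= Ainf_scl n w)%E.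
  apply: le_trans (ratio_le (top_node n)).
  by rewrite mule_ge0// lee_fin invr_ge0 -W_E ltW.
rewrite /L2w /SfL2w -/mu -/S -/X.
have n1 : 1 <= n%:R :> R by rewrite ler1n ltnW.
have Cn0 : 0 < 73 * n%:R :> R by rewrite mulr_gt0// (lt_le_trans ltr01).
case EA : (Ainf_scl n w) A0 => [A| |] // A0; last first.
  have [SE|Sn0] := eqVneq S 0%E.
    rewrite SE -[leRHS](_ : 0%E = _); last by rewrite sqrte0 mule0.
    rewrite -(@sqrte0 R) lee_sqrt// -X1.
    by apply: (integral_sq_eq0 n2 intf1 intw1 w10 W_gt0 f_root); rewrite S1.
  suff -> : ((73 * n%:R)%:E * sqrte +oo * sqrte S = +oo)%E by rewrite leey.
  rewrite /= gt0_muley ?lte_fin// gt0_mulye//.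
  rewrite lt_neqAle sqrte_ge0 andbT eq_sym; apply: contra Sn0 => /eqP h.
  by rewrite -(sqr_sqrte S0) h expe2 mule0.
have -> : (73 * n%:R)%:E = sqrte ((73 * n%:R) ^+ 2)%:E :> \bar R.
  by rewrite /= sqrtr_sqr ger0_norm// ltW.
rewrite -!sqrteM ?mule_ge0 ?lee_fin ?sqr_ge0//.
rewrite lee_sqrt ?mule_ge0 ?lee_fin ?sqr_ge0//.
have bd : (X <= (73 ^+ 2 * n%:R * A)%:E * S)%E.
  rewrite -X1 -S1; apply: integral_sq_le_Ssq => // t.
  have W_gt0t : 0 < navg n (lvl t) (pos t) w by rewrite -(W_E t).
  have := ratio_le t; rewrite EA (lee_pdivrMr _ _ W_gt0t) -(W_E t) -EFinM.
  apply: le_trans; rewrite le_eqVlt; apply/orP; left.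
  apply/eqP; congr (_ * _)%E; apply: eq_integral => x _.
  by apply: (locmax_w1 intw intw1 w1E); [exact: pt_ge0|exact: pt_le1 (pos_lt t)].
(* Under the root the bound has the factor [n], which is at most [n ^ 2]. *)
apply: (le_trans bd); rewrite -EFinM lee_wpmul2r// lee_fin ler_wpM2r//.
by rewrite exprMn ler_wpM2l// expr2 ler_peMl// (le_trans ler01).
Qed.
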